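(* Let $M\ge N\ge 1$ be integers and $K=\binom{N}{2}+N$. For $y\in\{0,\dots,M-1\}$ let ${\bm A}_y\in\{0,1\}^{M\times M}$ have $(i,j)$ entry $1$ if $i\le j$ and $j-i=y$, and $0$ otherwise, and let ${\bm B}_y={\bm A}_y+{\bm A}_y^T$. Let ${\bm x}\in\{0,1\}^M$ have exactly $N$ entries equal to $1$, and define $$f({\bm z})=\frac1M\sum_{y=0}^{M-1}\Big(\tfrac1K{\bm z}^T{\bm A}_y{\bm z}-\tfrac1K{\bm x}^T{\bm A}_y{\bm x}\Big)^2 .$$ Let $\mathcal{S}=\{{\bm z}\in\mathbb{R}^M: 0\le z_m\le 1\ \forall m,\ \|{\bm z}\|_1=N\}$ and let $\mathscr{P}_{\mathcal S}$ denote Euclidean projection onto $\mathcal S$. Let ${\bm E}=\sum_{y=0}^{M-1}{\bm B}_y{\bm x}{\bm x}^T{\bm B}_y^T$ and $\lambda_{\bm E}=\min_{\widehat{\bm h}\in\mathcal G}\widehat{\bm h}^T{\bm E}\widehat{\bm h}$, where $\mathcal G$ is the set of $\widehat{\bm h}\in\mathbb{R}^M$ with $\sum_i\widehat h_i=0$, $\widehat h_i\in[0,1/2]$ if $x_i=0$, $\widehat h_i\in[-1/2,0]$ if $x_i=1$, and $\|\widehat{\bm h}\|_1=1$ (one has $\lambda_{\bm E}>0$). Fix $q\in(\tfrac12,1)$ and set $\tau=\big(2-\tfrac1q\big)\sqrt{\lambda_{\bm E}/4}$. If ${\bm z}_t\in\mathcal S$, ${\bm z}_t\ne{\bm x}$,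 and $\|{\bm z}_t-{\bm x}\|_2<\tau$, then there exist $\mu\in(0,1)$ and a step size $\eta>0$, depending on $q,\tau,{\bm z}_t$, such that ${\bm z}_{t+1}=\mathscr{P}_{\mathcal S}\big({\bm z}_t-\eta\nabla f({\bm z}_t)\big)$ satisfies $$\|{\bm z}_{t+1}-{\bm x}\|_2<\mu^{1/2}\|{\bm z}_t-{\bm x}\|_2 .$$
   Context: This is the noiseless turnpike setting: ${\bm x}$ encodes $N$ points on a grid of $M$ cells, and ${\bm z}^T{\bm A}_y{\bm z}/K$ is the (relaxed) mass of pairwise distances equal to $y$. *)

(* Defs.v *)
From HB Require Import structures.
From mathcomp Require Import all_boot all_order all_algebra.
From mathcomp Require Import all_classical all_reals all_analysis.
From mathcomp Require Import lra ring.
Set Implicit Arguments.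
Unset Strict Implicit.
Unset Printing Implicit Defensive.
Import Order.TTheory GRing.Theory Num.Theory.
Import numFieldNormedType.Exports.

Local Open Scope classical_set_scope.
Local Open Scope ring_scope.

(* The library norm `|z| on 'cV[R]_M is the sup norm, hence these two. *)
Definition norm1 (R : realType) (M : nat) (z : 'cV[R]_M) : R :=
  \sum_(i < M) `|z i 0|.

Definition norm2 (R : realType) (M : nat) (z : 'cV[R]_M) : R :=
  Num.sqrt (\sum_(i < M) z i 0 ^+ 2).

Definition quad (R : realType) (M : nat) (A : 'M[R]_M) (z : 'cV[R]_M) : R :=
  (z^T *m A *m z) 0 0.

(* 'D_v f z is unspecified when the limit defining it does not exist; the
   function loss below is polynomial in z, so this does not arise there. *)
Definition gradient (R : realType) (M : nat) (f : 'cV[R]_M -> R)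
    (z : 'cV[R]_M) : 'cV[R]_M :=
  \col_(i < M) 'D_(delta_mx i 0) f z.

Definition is_nearest (R : realType) (M : nat) (S : set 'cV[R]_M)
    (w p : 'cV[R]_M) : Prop :=
  S p /\ forall s, S s -> norm2 (w - p) <= norm2 (w - s).

(* The default value w is never used for S = feasible N with N <= M: see
   euclid_proj_feasible_nearest and nearest_feasible_uniq below. *)
Definition euclid_proj (R : realType) (M : nat) (S : set 'cV[R]_M)
    (w : 'cV[R]_M) : 'cV[R]_M :=
  xget w [set p | is_nearest S w p].

Definition Amx (R : realType) (M : nat) (y : 'I_M) : 'M[R]_M :=
  \matrix_(i < M, j < M) ((i <= j)%N && (j - i == y)%N)%:R.

Definition Bmx (R : realType) (M : nat) (y : 'I_M) : 'M[R]_M :=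
  Amx R y + (Amx R y)^T.

Definition npairs (N : nat) : nat := ('C(N, 2) + N)%N.

Definition encodes_points (R : realType) (M N : nat) (x : 'cV[R]_M) : Prop :=
  (forall i, x i 0 = 0 \/ x i 0 = 1) /\ #|[pred i | x i 0 == 1]| = N.

Definition loss (R : realType) (M N : nat) (x z : 'cV[R]_M) : R :=
  M%:R^-1 * \sum_(y < M)
    ((npairs N)%:R^-1 * quad (Amx R y) z
     - (npairs N)%:R^-1 * quad (Amx R y) x) ^+ 2.

Definition feasible (R : realType) (M N : nat) : set 'cV[R]_M :=
  [set z : 'cV[R]_M | (forall m, 0 <= z m 0 <= 1) /\ norm1 z = N%:R].

Definition Emx (R : realType) (M : nat) (x : 'cV[R]_M) : 'M[R]_M :=
  \sum_(y < M) Bmx R y *m x *m x^T *m (Bmx R y)^T.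

Definition directions (R : realType) (M : nat) (x : 'cV[R]_M) :
    set 'cV[R]_M :=
  [set h : 'cV[R]_M | [/\ \sum_(i < M) h i 0 = 0,
              forall i, x i 0 = 0 -> 0 <= h i 0 <= 1 / 2,
              forall i, x i 0 = 1 -> - (1 / 2) <= h i 0 <= 0 &
              norm1 h = 1]].

(* A minimum whenever directions x is nonempty (lambdaE_min below). *)
Definition lambdaE (R : realType) (M : nat) (x : 'cV[R]_M) : R :=
  inf [set quad (Emx x) h | h in directions x].

Lemma compact_box_min (R : realType) (M : nat) (a b : 'I_M -> R)
    (f g1 g2 : 'cV[R]_M -> R) (c1 c2 : R) :
  (forall i, a i <= b i) ->
  continuous (fun v : 'rV[R]_M => f v^T) ->
  continuous (fun v : 'rV[R]_M => g1 v^T) ->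
  continuous (fun v : 'rV[R]_M => g2 v^T) ->
  forall A : set 'cV[R]_M,
  A = [set z : 'cV[R]_M | [/\ forall i, a i <= z i 0 <= b i, g1 z = c1 & g2 z = c2]] ->
  A !=set0 -> exists2 z, A z & forall s, A s -> f z <= f s.
Proof.
move=> ab cf cg1 cg2 A AE [z0 Az0].
pose B : set 'rV[R]_M := [set v | forall i, `[a i, b i]%classic (v 0 i)].
pose B1 : set 'rV[R]_M := (fun v => g1 v^T) @^-1` [set c1].
pose B2 : set 'rV[R]_M := (fun v => g2 v^T) @^-1` [set c2].
have cB : compact (B `&` B1 `&` B2).
  apply: compact_closedI; first apply: compact_closedI.
  - by apply: (@rV_compact _ _ (fun i => `[a i, b i]%classic)) => i;
      exact: segment_compact.
  - by apply: preimage_closed; [move=> ? _; exact: cg1 | exact: closed_eq].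
  - by apply: preimage_closed; [move=> ? _; exact: cg2 | exact: closed_eq].
have BA v : (B `&` B1 `&` B2) v <-> A v^T.
  rewrite AE; split.
    by move=> [[Bv ? ?]]; split=> // i; rewrite mxE; have := Bv i; rewrite /= in_itv.
  case=> Bv ? ?; split; [split|] => // i.
  by have := Bv i; rewrite mxE /= in_itv.
have ne : (B `&` B1 `&` B2) !=set0 by exists z0^T; apply/BA; rewrite trmxK.
have [c /set_mem Bc cmin] := compact_EVT_min ne cB (continuous_subspaceT cf).
exists c^T; first exact/BA.
by move=> s As; rewrite -(trmxK s); apply/cmin/mem_set/BA; rewrite trmxK.
Qed.

Lemma tr_coord_continuous (R : realType) (M : nat) (i : 'I_M) :
  continuous (fun v : 'rV[R]_M => v^T i 0).
Proof.
by under [X in continuous X]eq_fun do rewrite mxE; exact: coord_continuous.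
Qed.

Lemma sum_continuous (R : realType) (T : topologicalType) (I : Type)
    (r : seq I) (F : I -> T -> R) :
  (forall i, continuous (F i)) -> continuous (fun v => \sum_(i <- r) F i v).
Proof.
move=> cF; elim: r => [|i r IH].
  by under [X in continuous X]eq_fun do rewrite big_nil; exact: cst_continuous.
under [X in continuous X]eq_fun do rewrite big_cons.
by move=> v; apply: continuousD; [exact: cF | exact: IH].
Qed.

Lemma norm1_continuous (R : realType) (M : nat) :
  continuous (fun v : 'rV[R]_M => norm1 v^T).
Proof.
apply: sum_continuous => i v.
by apply: continuous_comp; [exact: tr_coord_continuous | exact: norm_continuous].
Qed.

Lemma quad_continuous (R : realType) (M : nat) (A : 'M[R]_M) :
  continuous (fun v : 'rV[R]_M => quad A v^T).
Proof.
have -> : (fun v : 'rV[R]_M => quad A v^T) =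
    fun v => \sum_(j < M) (\sum_(i < M) v^T i 0 * A i j) * v^T j 0.
  apply/funext => v; rewrite /quad mxE; apply: eq_bigr => j _.
  by rewrite trmxK mxE; congr (_ * _); apply: eq_bigr => i _; rewrite mxE.
apply: sum_continuous => j v; apply: continuousM; last exact: tr_coord_continuous.
apply: sum_continuous => i w.
by apply: continuousM; [exact: tr_coord_continuous | exact: cst_continuous].
Qed.

Lemma norm2_continuous (R : realType) (M : nat) (w : 'cV[R]_M) :
  continuous (fun v : 'rV[R]_M => norm2 (w - v^T)).
Proof.
move=> v; apply: (@continuous_comp _ _ _
  (fun v : 'rV[R]_M => \sum_(i < M) (w - v^T) i 0 ^+ 2) Num.sqrt);
  last exact: sqrt_continuous.
apply: sum_continuous => i {}v.
have -> : (fun v : 'rV[R]_M => (w - v^T) i 0 ^+ 2) =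
    fun v => (w i 0 - v^T i 0) * (w i 0 - v^T i 0).
  by apply/funext => u; rewrite !mxE expr2.
have cB : {for v, continuous (fun v : 'rV[R]_M => w i 0 - v^T i 0)}.
  by apply: continuousB; [exact: cst_continuous | exact: tr_coord_continuous].
exact: (continuousM cB cB).
Qed.

Lemma lambdaE_min (R : realType) (M N : nat) (x : 'cV[R]_M) :
  encodes_points N x -> directions x !=set0 ->
  exists2 h, directions x h &
    quad (Emx x) h = lambdaE x /\
    forall h', directions x h' -> lambdaE x <= quad (Emx x) h'.
Proof.
move=> [x01 _] ne.
pose a i : R := if x i 0 == 0 then 0 else - (1 / 2).
pose b i : R := if x i 0 == 0 then 1 / 2 else 0.
have AE : directions x = [set z : 'cV[R]_M | [/\ forall i, a i <= z i 0 <= b i,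
    \sum_(i < M) z i 0 = 0 & norm1 z = 1]].
  apply/seteqP; split=> h [].
    move=> s0 h0 h1 n1; split=> // i; rewrite /a /b.
    by case: (x01 i) => xi; rewrite xi ?oner_eq0 ?eqxx; [exact: h0|exact: h1].
  move=> hab s0 n1; split=> // i xi; have := hab i;
  by rewrite /a /b xi ?oner_eq0 ?eqxx.
have [||||h dh hmin] := compact_box_min _ _ _ _ AE ne (f := quad (Emx x)).
- by move=> i; rewrite /a /b; case: ifP => _; lra.
- exact: quad_continuous.
- by apply: sum_continuous => i; exact: tr_coord_continuous.
- exact: norm1_continuous.
have lE : lambdaE x = quad (Emx x) h.
  apply/eqP; rewrite eq_le; apply/andP; split.
    apply: ge_inf; last by exists h.
    by exists (quad (Emx x) h) => _ [s ds <-]; exact: hmin.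
  by apply: lb_le_inf; [exists (quad (Emx x) h), h | move=> _ [s ds <-]; exact: hmin].
by exists h => //; rewrite lE.
Qed.

Lemma euclid_proj_feasible_nearest (R : realType) (M N : nat) (w : 'cV[R]_M) :
  (N <= M)%N -> is_nearest (feasible N) w (euclid_proj (feasible N) w).
Proof.
move=> NM; rewrite /euclid_proj.
case: xgetP => [p _ //|noproj]; exfalso.
have AE : @feasible R M N = [set z : 'cV[R]_M | [/\ forall i : 'I_M, (0 : R) <= z i 0 <= 1,
    norm1 z = N%:R & norm1 z = N%:R]].
  by apply/seteqP; split=> z []; [move=> ? ?; split | move=> ? ? ?; split].
have ne : @feasible R M N !=set0.
  exists (\col_(i < M) (i < N)%:R); split=> [i|].
    by rewrite mxE; case: (_ < _)%N; rewrite ?lexx ler01.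
  rewrite /norm1; under eq_bigr do rewrite mxE normr_nat.
  rewrite -natr_sum; congr _%:R.
  rewrite -[RHS]card_ord -sum1_card.
  rewrite (big_ord_widen (idx := 0%N) (op := addn) M (fun=> 1%N) NM).
  by rewrite [RHS]big_mkcond.
have [||||p Sp pmin] := compact_box_min _ _ _ _ AE ne (f := fun z => norm2 (w - z)).
- by move=> i; exact: ler01.
- exact: norm2_continuous.
- exact: norm1_continuous.
- exact: norm1_continuous.
exact: (noproj p).
Qed.


Lemma nearest_feasible_uniq (R : realType) (M N : nat) (w p p' : 'cV[R]_M) :
  is_nearest (feasible N) w p -> is_nearest (feasible N) w p' -> p = p'.
Proof.
pose sq (z : 'cV[R]_M) := \sum_(i < M) z i 0 ^+ 2.
have sq_ge0 z : 0 <= sq z by apply: sumr_ge0 => i _; exact: sqr_ge0.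
have le2 (z z' : 'cV[R]_M) : (norm2 z <= norm2 z') = (sq z <= sq z').
  by rewrite /norm2 ler_sqrt //; exact: sq_ge0.
move=> [[p01 np] pmin] [[p'01 np'] p'min].
pose m : 'cV[R]_M := \col_i ((p i 0 + p' i 0) / 2).
have norm1E (z : 'cV[R]_M) : (forall i, 0 <= z i 0 <= 1) ->
    norm1 z = \sum_(i < M) z i 0.
  by move=> z01; apply: eq_bigr => i _; case/andP: (z01 i) => ? _; exact: ger0_norm.
have m01 i : 0 <= m i 0 <= 1.
  by rewrite mxE; move: (p01 i) (p'01 i) => /andP[? ?] /andP[? ?]; lra.
have Sm : feasible N m.
  split=> //; rewrite norm1E //; under eq_bigr do rewrite mxE.
  rewrite -mulr_suml big_split /= -!norm1E // np np'; lra.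
have := pmin _ Sm; have := p'min _ Sm; rewrite !le2 => h1 h2.
have E : sq (p - p') = 2 * sq (w - p) + 2 * sq (w - p') - 4 * sq (w - m).
  rewrite /sq !mulr_sumr -big_split -sumrB /=; apply: eq_bigr => i _.
  by rewrite !mxE; field.
have sq0 : sq (p - p') = 0.
  by apply/eqP; rewrite eq_le sq_ge0 andbT; lra.
apply/matrixP => i j; rewrite (ord1 j); apply/eqP; rewrite -subr_eq0 -sqrf_eq0.
have /eqP := sq0; rewrite psumr_eq0; last by move=> k _; exact: sqr_ge0.
by move=> /allP /(_ i (mem_index_enum i)); rewrite !mxE.
Qed.

(* Main.v *)
(* The feasible set is convex and contains x, so projecting onto it does not
   increase the distance to x, and the squared distance drops along a small step
   as soon as (z - x) . grad f(z) > 0. Put h = z - x, a_y = h . B_y x and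
   b_y = h^T A_y h: up to a positive factor the inner product is
   sum_y (a_y + b_y) (a_y + 2 b_y). Since h is a multiple of a direction in G,
   sum_y a_y^2 = h^T E h >= lambda_E |h|_1^2, whereas |b_y| <= |h|_2^2 and
   sum_y |b_y| <= |h|_1^2 give sum_y b_y^2 <= |h|_2^2 |h|_1^2. Hence the inner
   product is positive when |h|_2^2 < lambda_E / 4. *)

Require Import Defs.
From HB Require Import structures.
From mathcomp Require Import all_boot all_order all_algebra.
From mathcomp Require Import all_classical all_reals all_analysis.
From mathcomp Require Import lra ring zify.
Set Implicit Arguments.
Unset Strict Implicit.
Unset Printing Implicit Defensive.
Import Order.TTheory GRing.Theory Num.Theory.
Import numFieldNormedType.Exports.

Local Open Scope classical_set_scope.
Local Open Scope ring_scope.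

(** * Inner product and quadratic forms *)

Definition dot (R : realType) (M : nat) (u v : 'cV[R]_M) : R :=
  \sum_(i < M) u i 0 * v i 0.

Section Dot.
Variables (R : realType) (M : nat).
Implicit Types (u v w : 'cV[R]_M) (A : 'M[R]_M) (a : R).

Lemma dotE u v : dot u v = (u^T *m v) 0 0.
Proof. by rewrite mxE; apply: eq_bigr => i _; rewrite mxE. Qed.

Lemma dotC u v : dot u v = dot v u.
Proof. by apply: eq_bigr => i _; rewrite mulrC. Qed.

Lemma dotDr u v w : dot u (v + w) = dot u v + dot u w.
Proof. by rewrite -big_split; apply: eq_bigr => i _; rewrite mxE mulrDr. Qed.

Lemma dotZr a u v : dot u (a *: v) = a * dot u v.
Proof. by rewrite mulr_sumr; apply: eq_bigr => i _; rewrite mxE mulrCA. Qed.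

Lemma dotDl u v w : dot (v + w) u = dot v u + dot w u.
Proof. by rewrite dotC dotDr !(dotC u). Qed.

Lemma dotZl a u v : dot (a *: u) v = a * dot u v.
Proof. by rewrite dotC dotZr dotC. Qed.

Lemma dotNr u v : dot u (- v) = - dot u v.
Proof. by rewrite -scaleN1r dotZr mulN1r. Qed.

Lemma dotNl u v : dot (- u) v = - dot u v.
Proof. by rewrite dotC dotNr dotC. Qed.

Lemma dot_subsub u v :
  dot (u - v) (u - v) = dot u u - 2 * dot u v + dot v v.
Proof. by rewrite dotDr !dotDl !dotNr !dotNl (dotC v u); ring. Qed.

Lemma dot_sumr (I : finType) u (v : I -> 'cV[R]_M) :
  dot u (\sum_i v i) = \sum_i dot u (v i).
Proof.
rewrite /dot exchange_big; apply: eq_bigr => j _ /=.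
by rewrite summxE mulr_sumr.
Qed.

Lemma dot_deltal i u : dot (delta_mx i 0) u = u i 0.
Proof.
rewrite /dot (bigD1 i) //= mxE !eqxx mul1r big1 ?addr0 // => j ji.
by rewrite mxE (negPf ji) mul0r.
Qed.

Lemma dotvv u : dot u u = \sum_(i < M) u i 0 ^+ 2.
Proof. by apply: eq_bigr => i _; rewrite expr2. Qed.

Lemma dotvv_ge0 u : 0 <= dot u u.
Proof. by rewrite dotvv sumr_ge0 // => i _; exact: sqr_ge0. Qed.

Lemma norm2E u : norm2 u = Num.sqrt (dot u u).
Proof. by rewrite dotvv. Qed.

Lemma norm1_ge0 u : 0 <= norm1 u.
Proof. exact: sumr_ge0. Qed.

Lemma norm1_gt0 u : u <> 0 -> 0 < norm1 u.
Proof.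
move=> u0; rewrite lt_neqAle norm1_ge0 andbT; apply/eqP => n0; apply: u0.
apply/colP => i; rewrite mxE; apply/eqP; rewrite -normr_eq0.
by have /eqP := esym n0; rewrite psumr_eq0 // => /allP /(_ i (mem_index_enum i)).
Qed.

Lemma dot_mulmx u A v : dot u (A *m v) = dot (A^T *m u) v.
Proof. by rewrite !dotE trmx_mul trmxK mulmxA. Qed.

Lemma quadE A u : quad A u = dot u (A *m u).
Proof. by rewrite dotE mulmxA. Qed.

Lemma quad_scale A a u : quad A (a *: u) = a ^+ 2 * quad A u.
Proof. by rewrite !quadE -scalemxAr dotZl dotZr mulrA expr2. Qed.

Lemma dot_symmetrized A u : dot u ((A + A^T) *m u) = 2 * quad A u.
Proof.
by rewrite quadE mulmxDl dotDr (dot_mulmx _ A^T) trmxK (dotC (_ *m _)); ring.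
Qed.

Lemma quadD A u v : quad A (u + v) = quad A u + dot v ((A + A^T) *m u) + quad A v.
Proof.
rewrite !quadE mulmxDr mulmxDl !dotDl !dotDr (dot_mulmx v A^T) trmxK.
by rewrite (dotC (A *m v)); ring.
Qed.

(** Each summand of [Emx x] is the rank-one matrix [v *m v^T] with [v = Bmx R y *m x], so its form
    is a square. *)
Lemma quad_Emx (x h : 'cV[R]_M) :
  quad (Emx x) h = \sum_(y < M) dot h (Bmx R y *m x) ^+ 2.
Proof.
rewrite quadE /Emx mulmx_suml dot_sumr; apply: eq_bigr => y _.
rewrite -!mulmxA mulmxA dotE (mulmxA h^T) mxE big_ord1 expr2 -dotE; congr (_ * _).
by rewrite mulmxA -trmx_mul -dotE dotC.
Qed.

End Dot.

(** * Differentiation of quadratic forms and of the loss *)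

Section Gradient.
Variables (R : realType) (M : nat).

Global Instance is_derive_quad (A : 'M[R]_M) (z v : 'cV[R]_M) :
  is_derive z v (quad A) (dot v ((A + A^T) *m z)).
Proof.
have H : (fun t => t^-1 *: (quad A (t *: v + z) - quad A z)) @ 0^' -->
    dot v ((A + A^T) *m z).
  (* By [quadD] the difference quotient at [t != 0] is exactly affine in [t], with slope [quad A v];
     the limit is written as its value at 0. *)
  have -> : dot v ((A + A^T) *m z) = dot v ((A + A^T) *m z) + 0 * quad A v.
    by rewrite mul0r addr0.
  apply: (@cvg_trans _ ((fun t : R => dot v ((A + A^T) *m z) + t * quad A v) @ 0^')).
    apply: near_eq_cvg; near=> t.
    have t0 : t != 0 by near: t; exact: nbhs_dnbhs_neq.
    rewrite [t *: v + z]addrC quadD quad_scale dotZl /GRing.scale /=.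
    by field.
  apply: cvgD; first exact: cvg_cst.
  by apply: cvgMr_tmp; apply: nbhs_dnbhs.
by apply: DeriveDef; [apply/cvg_ex; eexists; exact: H | apply: cvg_lim H].
Unshelve. all: by end_near. Qed.

(** Chain rule: the square contributes the 2, the residual and its derivative one factor 1/K each,
    and [quad (Amx R y)] has gradient [Bmx R y *m z]. *)
Lemma gradient_loss (N : nat) (x z : 'cV[R]_M) :
  gradient (loss N x) z = (2 / (M%:R * (npairs N)%:R ^+ 2)) *:
    \sum_(y < M) (quad (Amx R y) z - quad (Amx R y) x) *: (Bmx R y *m z).
Proof.
apply/colP => i; rewrite mxE.
pose c : R := (npairs N)%:R^-1.
have D (y : 'I_M) : is_derive z (delta_mx i 0 : 'cV[R]_M)
    (fun w => (c * quad (Amx R y) w - c * quad (Amx R y) x) ^+ 2)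
    (2 * c ^+ 2 * ((quad (Amx R y) z - quad (Amx R y) x) * (Bmx R y *m z) i 0)).
  apply: is_derive_eq; rewrite dot_deltal /Bmx /GRing.scale /=; ring.
have /@derive_val E := is_deriveZ M%:R^-1 (is_derive_sum D).
rewrite (_ : loss N x = M%:R^-1 \*: \sum_(y < M)
    (fun w => (c * quad (Amx R y) w - c * quad (Amx R y) x) ^+ 2)); last first.
  by apply/funext => w; rewrite /loss /GRing.scale /= fct_sumE.
rewrite E mxE summxE; under [in RHS]eq_bigr do rewrite mxE.
rewrite -mulr_sumr /GRing.scale /= mulrA; congr (_ * _).
by rewrite invfM exprVn /c; ring.
Qed.

End Gradient.

(** * Convexity of the feasible set and the projection onto it *)

Section Projection.
Variables (R : realType) (M N : nat).
Implicit Types (w p x : 'cV[R]_M).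

Lemma norm1_sum w : (forall i, 0 <= w i 0) -> norm1 w = \sum_(i < M) w i 0.
Proof. by move=> w0; apply: eq_bigr => i _; exact: ger0_norm. Qed.

Lemma feasible_sum w : feasible N w -> \sum_(i < M) w i 0 = N%:R.
Proof. by case=> w01 <-; rewrite norm1_sum // => i; case/andP: (w01 i). Qed.

Lemma feasible_conv p x t : feasible N p -> feasible N x -> 0 <= t <= 1 ->
  feasible N (p + t *: (x - p)).
Proof.
move=> Fp Fx /andP[t0 t1].
have h01 i : 0 <= (p + t *: (x - p)) i 0 <= 1.
  by rewrite !mxE; have := Fp.1 i; have := Fx.1 i => /andP[? ?] /andP[? ?]; nra.
split=> //; rewrite norm1_sum; last by move=> i; case/andP: (h01 i).
under eq_bigr do rewrite !mxE.
by rewrite big_split -mulr_sumr sumrB /= !feasible_sum // subrr mulr0 addr0.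
Qed.

(** Variational inequality of a convex projection: were the angle at [p] acute, some point of the
    segment from [p] to [x] would be nearer to [w]. *)
Lemma nearest_obtuse w p x : is_nearest (feasible N) w p -> feasible N x ->
  dot (w - p) (x - p) <= 0.
Proof.
move=> [Fp pmin] Fx; rewrite leNgt; apply/negP => c0.
set c := dot _ _ in c0; pose D := dot (x - p) (x - p).
have D0 : 0 <= D by exact: dotvv_ge0.
(* Moving from p towards x by t changes the squared distance to w by
   t (t D - 2 c), negative for this t. *)
pose t := c / (c + D).
have cD : 0 < c + D by lra.
have t0 : 0 < t by rewrite divr_gt0.
have t1 : t <= 1 by rewrite ler_pdivrMr //; lra.
have tD : t * (c + D) = c by rewrite /t divfK // gt_eqF.
have Ft : feasible N (p + t *: (x - p)).
  by apply: feasible_conv => //; rewrite t1 ltW.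
have := pmin _ Ft; rewrite !norm2E ler_sqrt ?dotvv_ge0 // opprD addrA.
rewrite [in leRHS]dot_subsub !dotZl !dotZr -/c -/D.
have : t * D < c by nra.
nra.
Qed.

Lemma nearest_nonexpansive w p x : is_nearest (feasible N) w p -> feasible N x ->
  dot (p - x) (p - x) <= dot (w - x) (w - x).
Proof.
move=> np Fx; have := nearest_obtuse np Fx.
(* Expanding this square leaves a cross term whose sign is given by the obtuse angle at [p]. *)
have -> : w - x = (w - p) - (x - p) by rewrite opprB addrA subrK.
have -> : p - x = - (x - p) by rewrite opprB.
rewrite dot_subsub dotNr dotNl opprK.
have := dotvv_ge0 (w - p).
lra.
Qed.

End Projection.

(** * Bounds on the forms of A_y and E, and positivity of the descent inner product *)

Section Spectrum.
Variables (R : realType) (M N : nat).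
Implicit Types (x h z : 'cV[R]_M).

(** Serves for the rows and columns of a fixed A_y, and for the offsets y of a fixed pair (i, j). *)
Lemma sum_pred_le1 (T : finType) (P : pred T) :
  (forall i j, P i -> P j -> i = j) -> \sum_i (P i)%:R <= 1 :> R.
Proof.
move=> Pu; rewrite -natr_sum lern1.
have -> : (\sum_i P i)%N = #|P| by rewrite -sum1_card [RHS]big_mkcond.
by apply/card_le1_eqP => i j Pi Pj; exact: Pu.
Qed.

Lemma Amx_ge0 (y i j : 'I_M) : 0 <= Amx R y i j.
Proof. by rewrite mxE ler0n. Qed.

Lemma normr_quad_le (y : 'I_M) h :
  `|quad (Amx R y) h| <= \sum_i \sum_j Amx R y i j * (`|h i 0| * `|h j 0|).
Proof.
rewrite quadE; apply: le_trans (ler_norm_sum _ _ _) _.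
apply: ler_sum => i _; rewrite mxE mulr_sumr.
apply: le_trans (ler_norm_sum _ _ _) _; apply: ler_sum => j _.
by rewrite !normrM (ger0_norm (Amx_ge0 _ _ _)) mulrCA.
Qed.

(** A_y is a partial permutation matrix. Splitting each product by 2ab <= a^2 + b^2, every h_i^2 / 2
    is charged at most once through its row and once through its column. *)
Lemma normr_quad_le_dot (y : 'I_M) h : `|quad (Amx R y) h| <= dot h h.
Proof.
apply: le_trans (normr_quad_le _ _) _.
have row (i : 'I_M) : \sum_j Amx R y i j <= 1.
  under eq_bigr do rewrite mxE.
  apply: sum_pred_le1 => j k /andP[ij /eqP jy] /andP[ik /eqP ky].
  by apply: val_inj => /=; lia.
have col (j : 'I_M) : \sum_i Amx R y i j <= 1.
  under eq_bigr do rewrite mxE.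
  apply: sum_pred_le1 => i k /andP[ij /eqP jy] /andP[ik /eqP ky].
  by apply: val_inj => /=; lia.
apply: (@le_trans _ _ (\sum_i \sum_j
    (Amx R y i j * (h i 0 ^+ 2 / 2) + Amx R y i j * (h j 0 ^+ 2 / 2)))).
  apply: ler_sum => i _; apply: ler_sum => j _.
  rewrite -mulrDr ler_wpM2l ?Amx_ge0 // -(real_normK (num_real (h i 0))).
  rewrite -(real_normK (num_real (h j 0))).
  have := sqr_ge0 (`|h i 0| - `|h j 0|); nra.
under eq_bigr do rewrite big_split /=.
rewrite big_split /= [X in _ + X]exchange_big /= -big_split dotvv /=.
apply: ler_sum => i _; rewrite -!mulr_suml.
by have := row i; have := col i; have := sqr_ge0 (h i 0); nra.
Qed.

(** A pair (i, j) has at most one offset y, so the product of [|h i 0|] and [|h j 0|] is counted at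
    most once. *)
Lemma sum_normr_quad_le h : \sum_(y < M) `|quad (Amx R y) h| <= norm1 h ^+ 2.
Proof.
apply: le_trans (ler_sum _ (fun y _ => normr_quad_le y h)) _.
rewrite exchange_big expr2 mulr_suml; apply: ler_sum => i _ /=.
rewrite exchange_big mulr_sumr; apply: ler_sum => j _ /=.
rewrite -mulr_suml ler_piMl ?mulr_ge0 //.
under eq_bigr do rewrite mxE.
apply: sum_pred_le1 => y k /andP[ij /eqP jy] /andP[ik /eqP ky].
by apply: val_inj => /=; lia.
Qed.

Lemma sum_sqr_quad_le h :
  \sum_(y < M) quad (Amx R y) h ^+ 2 <= dot h h * norm1 h ^+ 2.
Proof.
apply: (@le_trans _ _ (\sum_(y < M) dot h h * `|quad (Amx R y) h|)).
  apply: ler_sum => y _; rewrite -(real_normK (num_real (quad _ _))) expr2.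
  by rewrite ler_wpM2r // normr_quad_le_dot.
by rewrite -mulr_sumr ler_wpM2l ?dotvv_ge0 // sum_normr_quad_le.
Qed.

Lemma Bmx0 (y : 'I_M) x : val y = 0%N -> Bmx R y *m x = 2 *: x.
Proof.
move=> y0; have A1 : Amx R y = 1%:M.
  by apply/matrixP => i j; rewrite !mxE y0 subn_eq0 -eqn_leq.
by rewrite /Bmx A1 trmx1 mulmxDl mul1mx -[2]/(1 + 1) scalerDl scale1r.
Qed.

(* On directions x the entries over the support of x are negative, hence sum
   to -1/2, and the single term y = 0 of the quadratic form is already 1. *)
Lemma directions_quad_ge1 x h : (0 < M)%N -> encodes_points N x ->
  directions x h -> 1 <= quad (Emx x) h.
Proof.
move=> M0 [x01 _] [h0 hx0 hx1 hn1]; rewrite quad_Emx (bigD1 (Ordinal M0)) //=.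
rewrite Bmx0 // dotZr ler_wpDr ?sumr_ge0 // => [y _|]; first exact: sqr_ge0.
(* The sign pattern gives |h_i| = (1 - 2 x_i) h_i. *)
have : norm1 h = \sum_(i < M) h i 0 - 2 * dot h x.
  rewrite mulr_sumr -sumrB; apply: eq_bigr => i _.
  case: (x01 i) => xi; rewrite xi.
    by rewrite ger0_norm ?mulr0 ?subr0 //; case/andP: (hx0 i xi).
  by rewrite ler0_norm; [ring|case/andP: (hx1 i xi)].
rewrite hn1 h0; nra.
Qed.

Lemma lambdaE_ge1 x : (0 < M)%N -> encodes_points N x -> directions x !=set0 ->
  1 <= lambdaE x.
Proof.
move=> M0 hx [h dh]; apply: lb_le_inf; first by exists (quad (Emx x) h), h.
by move=> _ [k dk <-]; exact: directions_quad_ge1.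
Qed.

Lemma lambdaE_le_quad x h : (0 < M)%N -> encodes_points N x -> directions x h ->
  lambdaE x <= quad (Emx x) h.
Proof.
move=> M0 hx dh; apply: ge_inf; last by exists h.
by exists 1 => _ [k dk <-]; exact: directions_quad_ge1.
Qed.

Lemma encodes_feasible x : encodes_points N x -> feasible N x.
Proof.
move=> [x01 xN]; split=> [i|].
  by case: (x01 i) => ->; rewrite ?lexx ler01.
rewrite -xN -sum1_card natr_sum big_mkcond /=; apply: eq_bigr => i _.
by case: (x01 i) => xi; rewrite inE xi ?eqxx ?normr1 // eq_sym oner_eq0 normr0.
Qed.

Lemma directions_normalize x z : encodes_points N x -> feasible N z -> z <> x ->
  directions x ((norm1 (z - x))^-1 *: (z - x)).
Proof.
move=> hx Fz zx; have Fx := encodes_feasible hx; have x01 := hx.1.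
set h := z - x; have h0 : \sum_(i < M) h i 0 = 0.
  under eq_bigr do rewrite !mxE.
  by rewrite sumrB (feasible_sum Fz) (feasible_sum Fx) subrr.
have n0 : 0 < norm1 h by apply: norm1_gt0 => /subr0_eq.
have hx0 i : x i 0 = 0 -> 0 <= h i 0 by rewrite !mxE => ->; have := Fz.1 i; lra.
have hx1 i : x i 0 = 1 -> h i 0 <= 0 by rewrite !mxE => ->; have := Fz.1 i; lra.
(* Zero sum makes h_i the negative of the sum of the other entries, so it is at most half of the l1
   norm; this yields the bounds 1/2 in [directions]. *)
have half i : 2 * `|h i 0| <= norm1 h.
  have := h0; rewrite (bigD1 i) //= => /eqP; rewrite addr_eq0 => /eqP hi.
  rewrite /norm1 (bigD1 i) //= mulr2n mulrDl !mul1r lerD2l [in leLHS]hi normrN.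
  exact: ler_norm_sum.
split.
- by under eq_bigr do rewrite mxE; rewrite -mulr_sumr h0 mulr0.
- move=> i xi; rewrite mxE mulrC ler_pdivrMr // divr_ge0 ?hx0 ?(ltW n0) //=.
  by have := half i; rewrite ger0_norm ?hx0 //; lra.
- move=> i xi; rewrite mxE [_^-1 * _]mulrC ler_pdivlMr // ler_pdivrMr //.
  rewrite mul0r hx1 // andbT.
  by have := half i; rewrite ler0_norm ?hx1 //; lra.
rewrite /norm1; under eq_bigr do rewrite mxE normrM.
by rewrite -mulr_sumr normfV ger0_norm ?mulVf ?gt_eqF // ltW.
Qed.

Lemma dot_gradient_loss_gt0 x z : (0 < N)%N -> (N <= M)%N -> encodes_points N x ->
  feasible N z -> z <> x -> dot (z - x) (z - x) < lambdaE x / 4 ->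
  0 < dot (z - x) (gradient (loss N x) z).
Proof.
move=> N0 NM hx Fz zx; set h := z - x => small.
have M0 := leq_trans N0 NM.
have n0 : 0 < norm1 h by apply: norm1_gt0 => /subr0_eq.
rewrite gradient_loss dotZr mulr_gt0 //.
  by rewrite divr_gt0 ?mulr_gt0 ?exprn_gt0 ?ltr0n // /npairs addn_gt0 N0 orbT.
(* The bound on the normalized direction, scaled back quadratically. *)
have big : lambdaE x * norm1 h ^+ 2 <= quad (Emx x) h.
  have := lambdaE_le_quad M0 hx (directions_normalize hx Fz zx).
  by rewrite quad_scale exprVn mulrC ler_pdivlMr ?exprn_gt0.
have zE : z = x + h by rewrite /h addrC subrK.
have Bz y : quad (Amx R y) z - quad (Amx R y) x =
    dot h (Bmx R y *m x) + quad (Amx R y) h.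
  by rewrite zE quadD /Bmx; ring.
have Bh y : dot h (Bmx R y *m z) = dot h (Bmx R y *m x) + 2 * quad (Amx R y) h.
  by rewrite zE mulmxDr dotDr -dot_symmetrized.
rewrite dot_sumr.
(* This minorant is at least (lambda_E / 4 - |h|_2^2) |h|_1^2, which is positive by [small]. *)
apply: (@lt_le_trans _ _ (\sum_(y < M)
    (dot h (Bmx R y *m x) ^+ 2 / 4 - quad (Amx R y) h ^+ 2))).
  rewrite sumrB -mulr_suml -quad_Emx.
  have := sum_sqr_quad_le h; have : 0 < norm1 h ^+ 2 by rewrite exprn_gt0.
  by nra.
(* (a + b) (a + 2 b) - (a^2 / 4 - b^2) = 3 (a / 2 + b)^2 *)
apply: ler_sum => y _; rewrite dotZr Bz Bh.
by have := sqr_ge0 (dot h (Bmx R y *m x) / 2 + quad (Amx R y) h); nra.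
Qed.

End Spectrum.

(** * Choice of step size and contraction factor *)

Theorem theorem1 (R : realType) (M N : nat) (hN : (1 <= N)%N) (hNM : (N <= M)%N)
    (x : 'cV[R]_M) (hx : encodes_points N x) :
  (directions x !=set0 -> 0 < lambdaE x) /\
  forall (q : R), 1 / 2 < q < 1 ->
  forall (tau : R), tau = (2 - 1 / q) * Num.sqrt (lambdaE x / 4) ->
  forall (zt : 'cV[R]_M),
    feasible N zt -> zt <> x -> norm2 (zt - x) < tau ->
  exists (mu eta : R), [/\ 0 < mu < 1, 0 < eta &
    norm2 (euclid_proj (feasible N) (zt - eta *: gradient (loss N x) zt) - x)
      < Num.sqrt mu * norm2 (zt - x)].
Proof.
have M0 := leq_trans hN hNM.
split=> [ne|q /andP[q12 q1] tau tauE z Fz zx ztau].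
  exact: lt_le_trans ltr01 (lambdaE_ge1 M0 hx ne).
set h := z - x in ztau *; set g := gradient _ z.
(* The normalized error itself shows that [directions x] is nonempty. *)
have l1 : 1 <= lambdaE x.
  by apply: (lambdaE_ge1 M0 hx); eexists; exact: directions_normalize hx Fz zx.
(* Since q < 1, the factor 2 - 1/q is below 1, so tau is at most the root of lambda_E / 4. *)
have small : dot h h < lambdaE x / 4.
  rewrite -ltr_sqrt; last lra.
  rewrite -norm2E; apply: lt_le_trans ztau _.
  rewrite tauE ler_piMl ?sqrtr_ge0 //.
  have : 1 < 1 / q by rewrite ltr_pdivlMr; lra.
  lra.
have c0 : 0 < dot h g by exact: dot_gradient_loss_gt0.
set c := dot h g in c0.
have gg0 : 0 < dot g g.
  rewrite lt_neqAle dotvv_ge0 andbT; apply/eqP => gg; move: c0; rewrite /c /dot.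
  rewrite big1 ?ltxx // => i _.
  have /eqP := esym gg; rewrite dotvv psumr_eq0; last by move=> k _; exact: sqr_ge0.
  by move=> /allP /(_ i (mem_index_enum i)); rewrite sqrf_eq0 => /eqP ->; rewrite mulr0.
(* Exact line search: this [eta] minimizes |h - eta g|_2^2, lowering |h|_2^2 by [eta * c]. *)
pose eta := c / dot g g; pose p := euclid_proj (feasible N) (z - eta *: g).
have eta0 : 0 < eta by rewrite divr_gt0.
have step : dot (p - x) (p - x) < dot h h.
  have Fx := encodes_feasible hx.
  have np := euclid_proj_feasible_nearest (z - eta *: g) hNM.
  apply: le_lt_trans (nearest_nonexpansive np Fx) _.
  rewrite addrAC -/h dot_subsub !dotZl !dotZr -/c.
  have : eta * dot g g = c by rewrite /eta divfK // gt_eqF.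
  have : 0 < eta * c by rewrite mulr_gt0.
  nra.
have H0 : 0 < dot h h by apply: le_lt_trans step; exact: dotvv_ge0.
have P0 := dotvv_ge0 (p - x).
(* The midpoint between 1 and the squared contraction ratio: this keeps the final inequality strict,
   and [mu] positive even if [p = x]. *)
pose mu := (dot (p - x) (p - x) + dot h h) / (2 * dot h h).
have mu0 : 0 < mu by rewrite divr_gt0; lra.
exists mu, eta; rewrite -/p; split=> //.
  by rewrite mu0 ltr_pdivrMr; lra.
rewrite !norm2E -sqrtrM ?(ltW mu0) // ltr_sqrt ?(mulr_gt0 mu0) //.
have : mu * dot h h = (dot (p - x) (p - x) + dot h h) / 2.
  by rewrite /mu; field; rewrite gt_eqF.
lra.
Qed.
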